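(* For every positive integer $k$, \[ \mu(1+x+y_1,\,1+x+y_2,\,\ldots,\,1+x+y_k) \;=\; \frac{1}{\pi}\,\mathrm{Ls}_{k+1}\!\left(\frac{\pi}{3}\right) \;-\; \frac{1}{\pi}\,\mathrm{Ls}_{k+1}(\pi), \] where the left-hand side is the multiple Mahler measure of the $k$ polynomials $1+x+y_j$ ($j=1,\dots,k$) in the $k+1$ variables $x,y_1,\ldots,y_k$.
   Context: For functions $P_1,\ldots,P_k$ of $n$ variables, the multiple Mahler measure is \[ \mu(P_1,\ldots,P_k) := \int_0^1\cdots\int_0^1 \prod_{j=1}^k \log\left|P_j\left(e^{2\pi i t_1},\ldots,e^{2\pi i t_n}\right)\right|\,\mathrm{d}t_1\cdots\mathrm{d}t_n . \] For integers $n\ge 1$ and real $\sigma$, the log-sine integral is $\mathrm{Ls}_n(\sigma) := -\int_0^{\sigma}\log^{n-1}\left|2\sin\frac{\theta}{2}\right|\,\mathrm{d}\theta$. *)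

(* Defs.v *)
From HB Require Import structures.
From mathcomp Require Import all_boot all_order all_algebra.
From mathcomp Require Import all_classical all_reals all_analysis.
From mathcomp Require Import complex.
Set Implicit Arguments. Unset Strict Implicit. Unset Printing Implicit Defensive.
Import Order.TTheory GRing.Theory Num.Theory.
Local Open Scope classical_set_scope.
Local Open Scope ring_scope.
Local Open Scope complex_scope.

Definition e2pi {R : realType} (t : R) : R[i] :=
  (cos (2 * pi * t)) +i* (sin (2 * pi * t)).

Fixpoint cube_integral {R : realType} (n : nat) : (('I_n -> R) -> R) -> R :=
  match n return (('I_n -> R) -> R) -> R with
  | 0 => fun F => F (fun i => 0)
  | m.+1 => fun F =>
      Rintegral (@lebesgue_measure R) `[0%R, 1%R]
        (fun t : R => cube_integral (fun v : 'I_m -> R =>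
           F (fun i : 'I_m.+1 =>
                match unlift ord0 i with None => t | Some j => v j end)))
  end.

Definition multi_mahler {R : realType} (n : nat)
    (Ps : seq (('I_n -> R[i]) -> R[i])) : R :=
  cube_integral (fun t : 'I_n -> R =>
    \prod_(P <- Ps) ln (ComplexField.Normc.normc (P (fun i => e2pi (t i))))).

(* log-sine integral Ls_n(sigma) = - int_0^sigma log^{n-1} |2 sin(theta/2)| dtheta
   (oriented integral) *)
Definition Ls {R : realType} (n : nat) (sigma : R) : R :=
  let f := fun theta : R => (ln `|2 * sin (theta / 2)|) ^+ n.-1 in
  if (0 <= sigma)%R then - Rintegral (@lebesgue_measure R) `[0%R, sigma] f
  else Rintegral (@lebesgue_measure R) `[sigma, 0%R] f.

(* Main.v *)
(* For fixed x the y_j separate, so the mean is the k-th power of the mean of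
   ln |a + e(t)| with a = 1 + x, which by Jensen's formula is ln (max 1 |a|); the
   two parameters with |a| = 1 are a null set, and off them the integrand is
   continuous. Since |1 + e(t)| = |2 cos (pi t)|, the remaining integral over t is
   that of ln^k (max 1 |2 sin (theta / 2)|) over [0, pi] up to 1 / pi, and the
   truncated logarithm vanishes exactly on [0, pi / 3]. *)
Require Import Defs.
From HB Require Import structures.
From mathcomp Require Import all_boot all_order all_algebra.
From mathcomp Require Import all_classical all_reals all_analysis.
From mathcomp Require Import measurable_realfun complex.
From mathcomp Require Import ring lra.
Import Order.TTheory GRing.Theory Num.Theory.
Local Open Scope ring_scope.

(** * Integrals over segments: substitution, splitting, exceptional points *)

Section RintegralReal.
Import numFieldNormedType.Exports.
Local Open Scope classical_set_scope.
Context {R : realType}.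
Notation mu := (@lebesgue_measure R).
Implicit Types (a b p q : R) (f g G : R -> R).

Lemma continuous_integrable_segment a b G : continuous G ->
  mu.-integrable `[a, b] (EFin \o G).
Proof.
move=> cG; apply: continuous_compact_integrable; first exact: segment_compact.
exact: continuous_subspaceT.
Qed.

Lemma Rintegral_affine G p q a b : 0 < p -> a <= b -> continuous G ->
  Rintegral mu `[p * a + q, p * b + q] G =
  p * Rintegral mu `[a, b] (fun x => G (p * x + q)).
Proof.
move=> p0 ab cG.
pose F := fun x : R => p * x + q.
have dF (x : R) : is_derive x 1 F p.
  have -> : F = p *: (id : R -> R) + cst q by [].
  by apply: is_derive_eq; rewrite addr0 -[LHS]/(p * 1) mulr1.
have F' : F^`() = cst p.
  by apply/funext => x; rewrite derive1E (@derive_val _ _ _ _ _ _ _ (dF x)).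
have cF : continuous F.
  move=> x; apply/differentiable_continuous/derivable1_diffP.
  exact: (@ex_derive _ _ _ _ _ _ _ (dF x)).
have cGF : continuous (G \o F).
  by move=> x; apply: continuous_comp; [exact: cF|exact: cG].
rewrite -[LHS]/(Rintegral mu `[F a, F b] G) -(RintegralZl p)//; last first.
  exact: continuous_integrable_segment.
rewrite /Rintegral integration_by_substitution_increasing//.
- by congr fine; apply: eq_integral => x _; rewrite F' /= mulrC.
- by move=> x y _ _; rewrite /F ltrD2r ltr_pM2l.
- by rewrite F' => x _; exact: cst_continuous.
- by rewrite F'; exact: is_cvg_cst.
- by rewrite F'; exact: is_cvg_cst.
- split.
  + by move=> x _; exact: (@ex_derive _ _ _ _ _ _ _ (dF x)).
  + by apply: cvg_at_right_filter; exact: cF.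
  + by apply: cvg_at_left_filter; exact: cF.
- exact: continuous_subspaceT.
Qed.

Lemma Rintegral_opp G a b : a <= b -> continuous G ->
  Rintegral mu `[- b, - a] G = Rintegral mu `[a, b] (fun x => G (- x)).
Proof.
move=> ab cG; rewrite /Rintegral integration_by_substitution_oppr//.
exact: continuous_subspaceT.
Qed.

Lemma Rintegral_split f a b c : a <= b -> b <= c ->
  mu.-integrable `[a, c] (EFin \o f) ->
  Rintegral mu `[a, c] f = Rintegral mu `[a, b] f + Rintegral mu `[b, c] f.
Proof.
move=> ab bc intf.
(* The two pieces share the null point [b]; dropping it from the second one makes them a
   partition. *)
rewrite -[X in _ + X]Rintegral_itv_obnd_cbnd; last first.
  apply: integrableS intf => //; apply: subset_itv; rewrite ?bnd_simp//.
by rewrite -(Rintegral_itvB intf) ?bnd_simp// addrC subrK.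
Qed.

(** Points are null, and [f] inherits measurability from [g]: it agrees with [g] off [r] and [s],
    and any function is measurable on a singleton. Thus [f] may be an iterated integral whose values
    at the two points are unknown. *)
Lemma eq_Rintegral_setD2 (r s : R) (D : set R) f g : measurable D ->
  measurable_fun D g ->
  (forall x, D x -> x != r -> x != s -> f x = g x) ->
  Rintegral mu D f = Rintegral mu D g.
Proof.
move=> mD mg fg.
have mD1 : measurable (D `\ r) by exact: measurableD.
have mD2 : measurable (D `\ r `\ s) by exact: measurableD.
have eqfg x : x \in D `\ r `\ s -> f x = g x.
  by rewrite inE => -[[Dx /eqP xr] /eqP xs]; exact: fg.
have mgD2 : measurable_fun (D `\ r `\ s) g.
  by apply: measurable_funS mg => // x [[]].
have mfD2 : measurable_fun (D `\ r `\ s) f.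
  by apply: eq_measurable_fun mgD2 => x /eqfg.
have mfD1 : measurable_fun (D `\ r) f.
  have [Ds|Ds] := pselect ((D `\ r) s); last first.
    by rewrite -(not_setD1 Ds).
  rewrite -(setD1K Ds); apply/measurable_funU => //.
  by split => //; exact: measurable_fun_set1.
have mgD1 : measurable_fun (D `\ r) g.
  by apply: measurable_funS mg => // x [].
rewrite /Rintegral -[in LHS](@integral_setD1 _ _ r)//; last exact/measurable_EFinP.
rewrite -[in RHS](@integral_setD1 _ _ r)//; last exact/measurable_EFinP.
rewrite -[in LHS](@integral_setD1 _ _ s)//; last exact/measurable_EFinP.
rewrite -[in RHS](@integral_setD1 _ _ s)//; last exact/measurable_EFinP.
by congr fine; apply: eq_integral => x /eqfg ->.
Qed.

End RintegralReal.

(** * Separation of variables in the iterated integral *)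

(** Induction peels off the first variable. Its factor [f t] is constant for the inner integrals and
    is absorbed into [c], which is why a general constant is carried along. *)
Lemma cube_integral_prod (R : realType) (k : nat) (c : R) (f : R -> R) :
  (@lebesgue_measure R).-integrable `[0, 1]%classic (EFin \o f) ->
  cube_integral (fun v : 'I_k -> R => c * \prod_(j < k) f (v j)) =
  c * (Rintegral (@lebesgue_measure R) `[0, 1]%classic f) ^+ k.
Proof.
move=> intf; elim: k c => [|k IHk] c /=; first by rewrite big_ord0 expr0.
set I := (X in _ = _ * X ^+ _).
transitivity (Rintegral (@lebesgue_measure R) `[0, 1]%classic
    (fun t => c * I ^+ k * f t)); last first.
  by rewrite RintegralZl// exprSr mulrA.
apply: eq_Rintegral => t _; rewrite mulrAC -IHk; congr cube_integral.
apply/funext => v; rewrite big_ord_recl unlift_none mulrA; congr (_ * _).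
by apply: eq_bigr => i _; rewrite liftK.
Qed.

(** Isolates the variable x; the factor [1 *] gives the inner integrand the shape treated by
    [cube_integral_prod]. *)
Lemma multi_mahler_pencil (R : realType) (k : nat) :
  multi_mahler (n := k.+1)
    [seq (fun z : 'I_k.+1 -> R[i] => 1 + z ord0 + z (lift ord0 j)) | j <- enum 'I_k]
  = Rintegral (@lebesgue_measure R) `[0, 1]%classic (fun t =>
     cube_integral (fun v : 'I_k -> R =>
      1 * \prod_(j < k) ln (ComplexField.Normc.normc (1 + e2pi t + e2pi (v j))))).
Proof.
rewrite /multi_mahler /=; apply: eq_Rintegral => t _; congr cube_integral.
apply/funext => v; rewrite big_map big_enum /= mul1r; apply: eq_bigr => j _.
by rewrite unlift_none liftK.
Qed.

(** * Jensen's formula for the mean of ln |a + e(t)| *)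

Section Jensen.
Import numFieldNormedType.Exports ComplexField.Normc.
Local Open Scope classical_set_scope.
Local Open Scope complex_scope.
Context {R : realType}.
Notation mu := (@lebesgue_measure R).
Implicit Types (a : R[i]) (t : R).

Lemma normc_e2pi t : normc (e2pi t) = 1.
Proof. by rewrite /= cos2Dsin2 sqrtr1. Qed.

Lemma e2piD_half t : e2pi (t + 2^-1) = - e2pi t.
Proof.
rewrite /e2pi (_ : 2 * pi * (t + 2^-1) = 2 * pi * t + pi); last by field.
by rewrite cosDpi sinDpi.
Qed.

Lemma e2pi_double t : e2pi (2 * t) = e2pi t ^+ 2.
Proof.
rewrite /e2pi (_ : 2 * pi * (2 * t) = (2 * pi * t) *+ 2); last by ring.
rewrite cos_mulr2n sin_mulr2n expr2; apply/eqP; rewrite eq_complex /=.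
have := cos2Dsin2 (2 * pi * t).
set c := cos _; set s := sin _ => cs; apply/andP; split; apply/eqP; last by ring.
by rewrite mulr2n -cs; ring.
Qed.

Lemma normc_ge0 a : 0 <= normc a.
Proof. by case: a => x y; exact: sqrtr_ge0. Qed.

Lemma normcN1 a : normc (- a) = normc a.
Proof. exact: normcN. Qed.

(** Reverse triangle inequality. For |a| different from 1 it keeps the argument of the logarithm
    away from 0. *)
Lemma normcD_e2pi_ge a t : `|1 - normc a| <= normc (a + e2pi t).
Proof.
have h1 : normc (e2pi t) <= normc (a + e2pi t) + normc a.
  rewrite -[X in normc X <= _](addKr a) -(normcN1 a) [leRHS]addrC.
  exact: le_normcD.
have h2 : normc a <= normc (a + e2pi t) + normc (e2pi t).
  rewrite -[X in normc X <= _](addrK (e2pi t)) -(normcN1 (e2pi t)).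
  exact: le_normcD.
move: h1 h2; rewrite normc_e2pi => h1 h2.
by rewrite ler_norml; apply/andP; split; lra.
Qed.

Lemma normcD_e2pi_le a t : normc (a + e2pi t) <= 1 + normc a.
Proof. by rewrite addrC -(normc_e2pi t); exact: le_normcD. Qed.

Lemma normcD_e2pi_gt0 a t : normc a != 1 -> 0 < normc (a + e2pi t).
Proof.
move=> a1; apply: lt_le_trans (normcD_e2pi_ge a t).
by rewrite normr_gt0 subr_eq0 eq_sym.
Qed.

Lemma continuous_normcD_e2pi a : continuous (fun t => normc (a + e2pi t)).
Proof.
case: a => x y.
have ccos : continuous (fun t => x + cos (2 * pi * t)).
  move=> t; apply: cvgD; first exact: cvg_cst.
  apply: continuous_comp; last exact: continuous_cos.
  exact: mulrl_continuous.
have csin : continuous (fun t => y + sin (2 * pi * t)).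
  move=> t; apply: cvgD; first exact: cvg_cst.
  apply: continuous_comp; last exact: continuous_sin.
  exact: mulrl_continuous.
have csum : continuous (fun t =>
    (x + cos (2 * pi * t)) ^+ 2 + (y + sin (2 * pi * t)) ^+ 2).
  move=> t; apply: cvgD.
    exact: (continuous_comp (ccos t) (@exprn_continuous _ 2 _)).
  exact: (continuous_comp (csin t) (@exprn_continuous _ 2 _)).
by move=> t; apply: (continuous_comp (csum t)); exact: sqrt_continuous.
Qed.

Lemma continuous_ln_normcD_e2pi a : normc a != 1 ->
  continuous (fun t => ln (normc (a + e2pi t))).
Proof.
move=> a1 t; apply: (@continuous_comp _ _ _ (fun t => normc (a + e2pi t))).
  exact: continuous_normcD_e2pi.
by apply: continuous_ln; exact: normcD_e2pi_gt0.
Qed.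

(** The logarithmic Mahler measure of the linear polynomial a + z. *)
Definition circle_log_mean a : R :=
  Rintegral mu `[0, 1] (fun t => ln (normc (a + e2pi t))).

(* Pairing t with t + 1/2 turns a + e(t) into a^2 - e(2t), so the mean doubles
   when a is replaced by - a^2; iterating forces it to vanish for |a| < 1. *)
Lemma Jensen_duplication a : normc a != 1 ->
  circle_log_mean a = circle_log_mean (- a ^+ 2) / 2.
Proof.
move=> a1.
have a21 : normc (- a ^+ 2) != 1.
  rewrite normcN1 expr2 normcM -expr2; apply: contra a1.
  (* |a|^2 = 1 would give |a| = 1, or |a| = -1, which is impossible for a modulus. *)
  by rewrite sqrf_eq1 => /orP[//|/eqP aN1]; have := normc_ge0 a; lra.
have c1 := continuous_ln_normcD_e2pi a a1.
have c2 := continuous_ln_normcD_e2pi _ a21.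
rewrite /circle_log_mean (@Rintegral_split _ _ 0 2^-1 1); [|lra|lra|]; last first.
  exact: continuous_integrable_segment.
(* The second half is moved onto the first by t -> t + 1/2, which changes the sign of [e2pi]. *)
rewrite [X in _ + X](_ : _ = Rintegral mu `[0, 2^-1]
    (fun t => ln (normc (a - e2pi t)))); last first.
  have := Rintegral_affine _ 1 2^-1 0 2^-1 ltr01 _ c1.
  rewrite (_ : 1 * 0 + 2^-1 = 2^-1 :> R); last by ring.
  rewrite (_ : 1 * 2^-1 + 2^-1 = 1 :> R); last by field.
  move=> ->; last lra.
  rewrite mul1r; apply: eq_Rintegral => t _.
  by rewrite mul1r e2piD_half.
have := Rintegral_affine _ 2 0 0 2^-1 _ _ c2.
rewrite (_ : 2 * 0 + 0 = 0 :> R); last by ring.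
rewrite (_ : 2 * 2^-1 + 0 = 1 :> R); last by field.
move=> ->; [|lra|lra].
rewrite mulrC mulKf//.
rewrite -RintegralD//=.
- apply: eq_Rintegral => t _.
  (* The logarithms combine through (a + e)(a - e) = a^2 - e^2, which up to sign is - a^2 +
     e(2t). *)
  rewrite -lnM ?posrE -?e2piD_half ?normcD_e2pi_gt0//.
  rewrite -normcM addr0 e2pi_double e2piD_half [X in normc X]mulrC -subr_sqr -normcN1.
  by rewrite opprB addrC.
- exact: continuous_integrable_segment.
- apply: continuous_integrable_segment.
  rewrite (_ : (fun _ => _) = fun t => ln (normc (- a + e2pi t))).
    by apply: continuous_ln_normcD_e2pi; rewrite normcN1.
  by apply/funext => t; rewrite -normcN1 opprB addrC.
Qed.

(** On this disc 1 - r <= |a + e(t)| <= 1 + r <= 1 / (1 - r), so the integrand obeys the same bound.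
    What matters is that it is uniform in [a]. *)
Lemma Jensen_bound (r : R) a : r < 1 -> normc a <= r ->
  `|circle_log_mean a| <= - ln (1 - r).
Proof.
move=> r1 ar; have cJ := continuous_ln_normcD_e2pi a.
have {}cJ : continuous (fun t => ln (normc (a + e2pi t))).
  by apply: cJ; rewrite lt_eqF//; lra.
have iJ := continuous_integrable_segment 0 1 _ cJ.
apply: le_trans (le_normr_Rintegral _ iJ) _; first by [].
rewrite [leRHS](_ : _ = Rintegral mu `[0, 1] (cst (- ln (1 - r)))); last first.
  rewrite Rintegral_cst//= lebesgue_measure_itv/= lte_fin ltr01.
  by rewrite oppr0 adde0 mulr1.
apply: le_Rintegral => //.
- exact: integrable_norm.
- by apply: continuous_integrable_segment => t; exact: cvg_cst.
move=> t _ /=; set y := normc _.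
have := normcD_e2pi_ge a t; have := normcD_e2pi_le a t; rewrite -/y => y1.
have a0 := normc_ge0 a.
rewrite ger0_norm; last lra.
move=> y2.
have y0 : 0 < y by lra.
rewrite ler_norml opprK; apply/andP; split.
  by rewrite ler_ln ?posrE//; lra.
rewrite -lnV ?posrE; last lra.
rewrite ler_ln ?posrE ?invr_gt0//; last lra.
rewrite -[leRHS]mul1r ler_pdivlMr; last lra.
nra.
Qed.

(** The disc of radius [r] is stable under b -> - b^2, so the same constant [C] bounds the mean
    after any number of duplications, and each duplication gains a factor 2. *)
Lemma Jensen_lt1 a : normc a < 1 -> circle_log_mean a = 0.
Proof.
move=> a1; set r := normc a in a1; set C := - ln (1 - r).
have dyadic n b : normc b <= r -> `|circle_log_mean b| * 2 ^+ n <= C.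
  elim: n b => [|n IHn] b br; first by rewrite expr0 mulr1; exact: Jensen_bound.
  have b0 := normc_ge0 b.
  rewrite Jensen_duplication; last by rewrite lt_eqF//; lra.
  rewrite normrM [X in _ * X * _]ger0_norm// (exprS 2 n) mulrA mulfVK//.
  by apply: IHn; rewrite normcN1 expr2 normcM; nra.
apply/eqP; rewrite -normr_le0 leNgt; apply/negP => Ja.
have C0 : 0 <= C / `|circle_log_mean a|.
  rewrite divr_ge0 ?normr_ge0// oppr_ge0 ln_le0//.
  by have := normc_ge0 a; rewrite -/r; lra.
(* A nonzero mean would force 2^n <= C / |mean| for all n, whereas the Archimedean [n] satisfies C /
   |mean| < n < 2^n. *)
have /archi_boundP := C0; set n := Num.bound _ => Cn.
have := dyadic n a (lexx _); rewrite mulrC -ler_pdivlMr// leNgt => /negP; apply.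
apply: lt_trans Cn _; rewrite -natrX ltr_nat; exact: ltn_expl.
Qed.

(* Reflection in the unit circle: |a + e| = |a| |b + e| for |e| = 1, where
   b = 1 / conj a. *)
Lemma Jensen_gt1 a : 1 < normc a -> circle_log_mean a = ln (normc a).
Proof.
case: a => x y a1; set N := x ^+ 2 + y ^+ 2.
have N1 : 1 < N.
  rewrite -(@sqr_sqrtr _ N) ?addr_ge0 ?sqr_ge0//.
  by move: a1; rewrite /= -/N => a1; nra.
have N0 : N != 0 by rewrite gt_eqF//; lra.
have sqrN : (x / N) ^+ 2 + (y / N) ^+ 2 = N^-1.
  by rewrite !expr_div_n -mulrDl -/N expr2 invfM mulrA divff// mul1r.
pose b := (x / N) +i* (y / N).
have b1 : normc b < 1.
  rewrite /b /= -sqrtr1 ltr_sqrt//.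
  by rewrite sqrN invf_lt1//; lra.
have eqab t : normc ((x +i* y) + e2pi t) = normc (x +i* y) * normc (b + e2pi t).
  rewrite /= -sqrtrM; last by rewrite -/N; lra.
  (* With N = |a|^2, both squared moduli equal N + 2 (x c + y s) + 1. *)
  congr Num.sqrt; have := cos2Dsin2 (2 * pi * t).
  set c := cos _; set s := sin _ => cs.
  rewrite (_ : (x / N + c) ^+ 2 + (y / N + s) ^+ 2 =
    ((x / N) ^+ 2 + (y / N) ^+ 2) + 2 * (x * c + y * s) / N +
    (c ^+ 2 + s ^+ 2)); last by ring.
  rewrite (_ : (x + c) ^+ 2 + (y + s) ^+ 2 =
    N + 2 * (x * c + y * s) + (c ^+ 2 + s ^+ 2)); last by rewrite /N; ring.
  by rewrite sqrN cs -/N; field.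
have b1' : normc b != 1 by rewrite lt_eqF.
transitivity (Rintegral mu `[0, 1]
    (fun t => ln (normc (x +i* y)) + ln (normc (b + e2pi t)))).
  apply: eq_Rintegral => t _.
  by rewrite eqab lnM ?posrE ?normcD_e2pi_gt0//; lra.
rewrite RintegralD//.
- rewrite -/(circle_log_mean b) Jensen_lt1// addr0 Rintegral_cst//= lebesgue_measure_itv/=.
  by rewrite lte_fin ltr01 oppr0 adde0 mulr1.
- by apply: continuous_integrable_segment => t; exact: cvg_cst.
- by apply: continuous_integrable_segment; exact: continuous_ln_normcD_e2pi.
Qed.

End Jensen.

Lemma circle_log_meanE (R : realType) (a : R[i]) :
  ComplexField.Normc.normc a != 1 ->
  circle_log_mean a = ln (Num.max 1 (ComplexField.Normc.normc a)).
Proof.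
move=> a1; case: (ltgtP 1 (ComplexField.Normc.normc a)) => [a_gt1|a_lt1|a_eq1].
- by rewrite Jensen_gt1.
- by rewrite Jensen_lt1// ln1.
- by rewrite -a_eq1 eqxx in a1.
Qed.

(** * Integrability of the powers of ln |2 sin (theta / 2)| *)

Section LogSine.
Import numFieldNormedType.Exports.
Local Open Scope classical_set_scope.
Context {R : realType}.
Notation mu := (@lebesgue_measure R).
Implicit Types (x theta : R) (k n : nat).

(** The triple angle formula at pi / 6 reads 1 = 3 s - 4 s^3, that is (s + 1) (2 s - 1)^2 = 0, and s
    > 0 excludes the root -1. *)
Lemma sin_pi6 : sin (pi / 6) = 2^-1 :> R.
Proof.
have s0 : 0 < sin (pi / 6 : R) by apply: sin_gt0_pi; have := pi_gt0 R; lra.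
have := @sin_pihalf R.
rewrite (_ : pi / 2 = (pi / 6) *+ 2 + pi / 6 :> R); last by rewrite mulr2n; field.
rewrite sinD sin_mulr2n cos_mulr2n.
have := cos2Dsin2 (pi / 6 : R).
set s := sin _ in s0 *; set c := cos _ => cs.
rewrite (_ : _ + _ = 3 * s - 4 * s ^+ 3); last first.
  rewrite !mulr2n; have c2 : c * c = 1 - s * s by rewrite -expr2 -cs; ring.
  by rewrite [c ^+ 2]expr2 (_ : (c * s + c * s) * c = 2 * s * (c * c));
    [rewrite c2; ring|ring].
move=> s1; have : (s + 1) * (2 * s - 1) ^+ 2 = 0.
  by rewrite (_ : _ * _ = 1 - (3 * s - 4 * s ^+ 3)); [rewrite s1 subrr|ring].
move=> /eqP; rewrite mulf_eq0 sqrf_eq0 => /orP[/eqP|/eqP]; first lra.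
by lra.
Qed.

Lemma sin_le_half theta : 0 <= theta -> theta <= pi / 3 ->
  sin (theta / 2) <= 2^-1.
Proof.
move=> t0 tpi; rewrite -[leRHS]sin_pi6; have := pi_gt0 R => p0.
rewrite leNgt ltr_sin ?in_itv/=; first by rewrite -leNgt; lra.
- by apply/andP; split; lra.
- by apply/andP; split; lra.
Qed.

Lemma sin_ge_half theta : pi / 3 <= theta -> theta <= pi ->
  2^-1 <= sin (theta / 2).
Proof.
move=> t0 tpi; rewrite -[leLHS]sin_pi6; have := pi_gt0 R => p0.
rewrite leNgt ltr_sin ?in_itv/=; first by rewrite -leNgt; lra.
- by apply/andP; split; lra.
- by apply/andP; split; lra.
Qed.

(** The exponential on the right is x^(-1/2), an integrable singularity. With u = - ln x / 2 the
    claim is u^k <= k! e^u, one term of the exponential series. *)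
Lemma normr_ln_exp_le k x : 0 < x -> x <= 1 ->
  `|ln x| ^+ k <= 2 ^+ k * k`!%:R * expR (- (ln x / 2)).
Proof.
move=> x0 x1; have lnx : ln x <= 0 by exact: ln_le0.
rewrite ler0_norm//; set u := - (ln x / 2).
have u0 : 0 <= u by rewrite /u; lra.
have -> : - ln x = 2 * u by rewrite /u; field.
rewrite exprMn -mulrA ler_pM2l ?exprn_gt0//.
case: k => [|k].
  by rewrite expr0 fact0 mul1r -(@expR0 R) ler_expR.
rewrite mulrC -ler_pdivrMr ?ltr0n ?fact_gt0//.
by have := expR_ge1Dxn k u0; lra.
Qed.

(* [root_two_sin] is 2 sqrt(2 sin(theta/2)); its derivative is an integrable
   majorant, up to a constant, of every power of ln (2 sin(theta/2)) near 0. *)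
Definition root_two_sin theta : R := 2 * expR (ln (2 * sin (theta / 2)) / 2).
Definition root_two_sin' theta : R :=
  cos (theta / 2) * expR (- (ln (2 * sin (theta / 2)) / 2)).

Lemma two_sin_half_gt0 theta : 0 < theta -> theta < pi ->
  0 < 2 * sin (theta / 2).
Proof.
move=> t0 tpi; rewrite mulr_gt0//; apply: sin_gt0_pi; have := pi_gt0 R; lra.
Qed.

Lemma is_derive_root_two_sin theta : 0 < theta -> theta < pi ->
  is_derive theta 1 root_two_sin (root_two_sin' theta).
Proof.
move=> t0 tpi; have s0 := two_sin_half_gt0 _ t0 tpi.
have dh : is_derive theta 1 (fun t : R => t / 2) 2^-1.
  rewrite (_ : (fun t => t / 2) = 2^-1 *: (id : R -> R)); last first.
    by apply/funext => t; rewrite /= mulrC.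
  by apply: is_derive_eq; rewrite -[LHS]/(2^-1 * 1) mulr1.
pose h t : R := t / 2.
have dsin := @is_derive1_comp _ sin h theta _ _ (is_derive_sin _) dh.
have ds : is_derive theta 1 (2 \*: (sin \o h)) _ := is_deriveZ 2 dsin.
have dl := @is_derive1_comp _ (@ln R) _ theta _ _ (is_derive1_ln s0) ds.
have dl2 : is_derive theta 1 (2^-1 \*: (@ln R \o (2 \*: (sin \o h)))) _ :=
  is_deriveZ 2^-1 dl.
have de := @is_derive1_comp _ expR _ theta _ _ (is_derive_expR _) dl2.
have dF : is_derive theta 1
  (2 \*: (expR \o (2^-1 \*: (@ln R \o (2 \*: (sin \o h)))))) _ := is_deriveZ 2 de.
have eqF : root_two_sin = 2 \*: (expR \o (2^-1 \*: (@ln R \o (2 \*: (sin \o h))))).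
  by apply/funext => t; rewrite /root_two_sin /=; congr (2 * expR _); rewrite mulrC.
rewrite eqF; apply: (is_derive_eq dF).
set S := 2 * sin (theta / 2) in s0 *.
(* Writing 1 / S as an exponential lets it merge with S^(1/2) into S^(-1/2). *)
have eS : S^-1 = expR (- ln S) by rewrite expRN lnK.
rewrite -[LHS]/(2 * (expR (2^-1 * ln S) * (2^-1 *
  (S^-1 * (2 * (cos (theta / 2) / 2)))))) eS.
rewrite /root_two_sin' -/S (_ : - (ln S / 2) = 2^-1 * ln S - ln S); last by field.
by rewrite expRD; field.
Qed.

Lemma continuous_two_sin_half : continuous (fun theta : R => 2 * sin (theta / 2)).
Proof.
move=> t; apply: cvgM; first exact: cvg_cst.
apply: continuous_comp; last exact: continuous_sin.
exact: mulrr_continuous.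
Qed.

Lemma continuous_root_two_sin' theta : 0 < theta -> theta < pi ->
  {for theta, continuous root_two_sin'}.
Proof.
move=> t0 tpi; have s0 := two_sin_half_gt0 _ t0 tpi.
apply: cvgM.
  apply: continuous_comp; last exact: continuous_cos.
  exact: mulrr_continuous.
apply: continuous_comp; last exact: continuous_expR.
apply: cvgN; apply: cvgM; last exact: cvg_cst.
apply: (continuous_comp (continuous_two_sin_half _)).
exact: continuous_ln.
Qed.

Lemma measurable_root_two_sin' : measurable_fun setT root_two_sin'.
Proof.
apply: measurable_funM.
  apply: continuous_measurable_fun => t.
  apply: continuous_comp; last exact: continuous_cos.
  exact: mulrr_continuous.
apply: (measurableT_comp (@measurable_expR R)).
apply: measurable_funN; apply: measurable_funM => //.
apply: (measurableT_comp (@measurable_ln R)).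
apply: continuous_measurable_fun; exact: continuous_two_sin_half.
Qed.

Lemma measurable_ln_sin k :
  measurable_fun setT (fun theta : R => ln `|2 * sin (theta / 2)| ^+ k).
Proof.
apply: measurable_funX; apply: (measurableT_comp (@measurable_ln R)).
apply: (measurableT_comp (@normr_measurable R setT)).
apply: continuous_measurable_fun; exact: continuous_two_sin_half.
Qed.

(** Monotone convergence along segments that avoid 0. On each, the fundamental theorem gives a
    difference of values of [root_two_sin]: the upper one is 2, since 2 sin (pi / 6) = 1, and the
    lower one is nonnegative. *)
Lemma integral_root_two_sin'_le2 :
  (\int[mu]_(theta in `]0%R, (pi / 3)%R]) (root_two_sin' theta)%:E <= 2%:E)%E.
Proof.
have p2 := pi_ge2 R.
have p3 : pi / 3 < pi :> R by lra.
have p32 : 2^-1 < pi / 3 :> R by lra.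
(* Starting at [n.+2] keeps the left endpoint at most 1/2, hence below pi / 3, already for n = 0. *)
pose A n : set R := `[n.+2%:R^-1, pi / 3].
have An n : 0 < (n.+2%:R^-1 : R) <= 2^-1.
  by rewrite invr_gt0 ltr0n /= lef_pV2 ?posrE ?ltr0n// ler_nat.
have UA : `]0, pi / 3] = \bigcup_n A n.
  apply/seteqP; split => [x|x [n _]]; rewrite /A /= !in_itv/=.
    move=> /andP[x0 xpi].
    have /archi_boundP : 0 <= x^-1 by rewrite invr_ge0 ltW.
    set n := Num.bound _ => xn; exists n => //; rewrite /A /= in_itv/= xpi andbT.
    rewrite -[leRHS]invrK lef_pV2 ?posrE ?invr_gt0 ?ltr0n//.
    by apply/ltW/(lt_trans xn); rewrite ltr_nat.
  by have := An n => /andP[n0 _] /andP[nx ->]; rewrite (lt_le_trans n0 nx).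
have w0 x : 0 < x -> x <= pi / 3 -> 0 <= root_two_sin' x.
  move=> x0 x3; rewrite mulr_ge0 ?expR_ge0//.
  by apply: cos_ge0_pihalf; apply/andP; split; lra.
have cvgA : (\int[mu]_(x in A i) (root_two_sin' x)%:E)%E @[i --> \oo] -->
    (\int[mu]_(x in \bigcup_i A i) (root_two_sin' x)%:E)%E.
  apply: ge0_nondecreasing_set_cvg_integral.
  - move=> n m nm; apply/subsetPset => x; rewrite /A /= !in_itv/= => /andP[nx ->].
    rewrite andbT (le_trans _ nx)// lef_pV2 ?posrE ?ltr0n// ler_nat.
    by rewrite !ltnS.
  - by move=> n; exact: measurable_itv.
  - move=> n; apply/measurable_EFinP; exact: measurable_funS measurable_root_two_sin'.
  - move=> n x; rewrite /A /= in_itv/= => /andP[nx x3]; rewrite lee_fin w0//.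
    by have /andP[n0 _] := An n; exact: lt_le_trans nx.
rewrite UA -(cvg_lim _ cvgA)//; apply: lime_le.
  by apply/cvg_ex; eexists; exact: cvgA.
apply: nearW => n; have /andP[n0 n2] := An n.
have dF x : n.+2%:R^-1 <= x -> x <= pi / 3 -> is_derive x 1 root_two_sin (root_two_sin' x).
  move=> nx x3.
  by apply: is_derive_root_two_sin; [exact: lt_le_trans nx|exact: le_lt_trans x3 _].
have cF x : n.+2%:R^-1 <= x -> x <= pi / 3 -> {for x, continuous root_two_sin}.
  move=> nx x3; apply/differentiable_continuous/derivable1_diffP.
  exact: (@ex_derive _ _ _ _ _ _ _ (dF x nx x3)).
have n3 : n.+2%:R^-1 < pi / 3 :> R by exact: le_lt_trans n2 _.
rewrite (@continuous_FTC2 _ root_two_sin' root_two_sin)//.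
- rewrite -EFinB lee_fin; have : root_two_sin (pi / 3) = 2.
    rewrite /root_two_sin (_ : pi / 3 / 2 = pi / 6 :> R); last by field.
    by rewrite sin_pi6 mulfV// ln1 mul0r expR0 mulr1.
  by have := expR_ge0 (ln (2 * sin (n.+2%:R^-1 / 2 : R)) / 2); rewrite /root_two_sin; lra.
- apply: continuous_in_subspaceT => x; rewrite inE /= in_itv/= => /andP[nx x3].
  by apply: continuous_root_two_sin'; [exact: lt_le_trans nx|exact: le_lt_trans x3 _].
- split.
  + move=> x; rewrite in_itv/= => /andP[/ltW nx /ltW x3].
    exact: (@ex_derive _ _ _ _ _ _ _ (dF x nx x3)).
  + by apply: cvg_at_right_filter; apply: cF => //; exact: ltW.
  + by apply: cvg_at_left_filter; apply: cF => //; exact: ltW.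
- move=> x; rewrite in_itv/= => /andP[/ltW nx /ltW x3].
  by rewrite derive1E (@derive_val _ _ _ _ _ _ _ (dF x nx x3)).
Qed.

Lemma ln_sin_le_root_two_sin' k theta : 0 < theta -> theta <= pi / 3 ->
  `|ln `|2 * sin (theta / 2)| ^+ k| <= 2 ^+ k * k`!%:R * 2 * root_two_sin' theta.
Proof.
move=> t0 t3; have p0 := pi_gt0 R.
have s0 : 0 < 2 * sin (theta / 2) by apply: two_sin_half_gt0; lra.
have s1 := sin_le_half _ (ltW t0) t3.
(* This bound on the cosine in [root_two_sin'] is paid for by the extra factor 2 in the majorant. *)
have c1 : 2^-1 <= cos (theta / 2).
  have c0 : 0 <= cos (theta / 2).
    by apply: cos_ge0_pihalf; apply/andP; split; lra.
  have := cos2Dsin2 (theta / 2); nra.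
rewrite normrX [X in ln X]ger0_norm; last exact: ltW.
apply: le_trans (normr_ln_exp_le k _ s0 _) _; first lra.
rewrite -[leRHS]mulrA ler_wpM2l ?mulr_ge0 ?exprn_ge0//.
rewrite /root_two_sin' mulrA ler_peMl ?expR_ge0//; lra.
Qed.

(** Split at pi / 3: to the left the power is dominated by a multiple of [root_two_sin'], to the
    right 1 <= 2 sin (theta / 2) <= 2 and the logarithm lies between 0 and ln 2. *)
Lemma integrable_ln_sin_pow k :
  mu.-integrable `[0, pi] (EFin \o (fun theta : R => ln `|2 * sin (theta / 2)| ^+ k)).
Proof.
have p0 := pi_gt0 R.
set f := fun theta : R => _.
have mf D : measurable D -> measurable_fun D (fun x => `|(f x)%:E|%E).
  move=> mD; apply: measurableT_comp => //; apply/measurable_EFinP.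
  by apply: measurable_funS (measurable_ln_sin k).
apply/integrableP; split.
  by apply/measurable_EFinP; apply: measurable_funS (measurable_ln_sin k).
rewrite (@itv_bndbnd_setU _ _ _ (BRight (pi / 3))); [|rewrite bnd_simp; lra..].
rewrite ge0_integral_setU//=; [|by apply: mf; exact: measurableU|]; last first.
  apply/disj_setPS => y [/=]; rewrite 2!in_itv/= => /andP[_ yx] /andP[].
  by rewrite ltNge yx.
apply: lte_add_pinfty.
(* The singular endpoint 0 is removed, as the majorant is only available for theta > 0. *)
- rewrite -integral_itv_obnd_cbnd; last exact: mf.
  apply: (@le_lt_trans _ _ (\int[mu]_(x in `]0%R, (pi / 3)%R])
      ((2 ^+ k * k`!%:R * 2)%:E * (root_two_sin' x)%:E))%E).
    apply: ge0_le_integral => //.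
    + exact: mf.
    + apply: measurable_funeM; apply/measurable_EFinP.
      exact: measurable_funS measurable_root_two_sin'.
    + move=> x; rewrite /= in_itv/= => /andP[x0 x3].
      by rewrite -EFinM lee_fin ln_sin_le_root_two_sin'.
  rewrite ge0_integralZl//.
  + apply: lte_mul_pinfty => //.
    by apply: le_lt_trans integral_root_two_sin'_le2 _; exact: ltry.
  + by apply/measurable_EFinP; exact: measurable_funS measurable_root_two_sin'.
  + move=> x; rewrite /= in_itv/= => /andP[x0 x3]; rewrite lee_fin.
    rewrite mulr_ge0 ?expR_ge0//.
    by apply: cos_ge0_pihalf; apply/andP; split; lra.
- apply: (@le_lt_trans _ _ (\int[mu]_(x in `](pi / 3)%R, pi]) (ln 2 ^+ k)%:E)%E).
    apply: ge0_le_integral => //; first exact: mf.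
    move=> x; rewrite /= in_itv/= => /andP[x3 xpi]; rewrite lee_fin /f normrX.
    have s1 := sin_ge_half _ (ltW x3) xpi; have s2 := sin_le1 (x / 2).
    rewrite [X in ln X]ger0_norm; last lra.
    rewrite ger0_norm; last by rewrite ln_ge0; lra.
    rewrite lerXn2r ?nnegrE ?ln_ge0//; [lra|lra|].
    by rewrite ler_ln ?posrE; lra.
  rewrite integral_cst//= lebesgue_measure_itv/= lte_fin ifT; last lra.
  by rewrite -EFinB -EFinM ltry.
Qed.

End LogSine.

(** * The modulus of 1 + e(t) and where it equals 1 *)

Lemma normc1D_e2pi (R : realType) (t : R) :
  ComplexField.Normc.normc (1 + e2pi t) = `|2 * cos (pi * t)|.
Proof.
rewrite /= -sqrtr_sqr; congr Num.sqrt.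
rewrite (_ : 2 * pi * t = (pi * t) *+ 2); last by ring.
rewrite cos_mulr2n sin_mulr2n; have := cos2Dsin2 (pi * t).
set c := cos _; set s := sin _ => cs.
have -> : (0 + (c * s) *+ 2) ^+ 2 = 4 * c ^+ 2 * s ^+ 2 by ring.
have -> : s ^+ 2 = 1 - c ^+ 2 by rewrite -cs; ring.
by ring.
Qed.

Lemma cos_pi3 (R : realType) : cos (pi / 3) = 2^-1 :> R.
Proof.
rewrite (_ : pi / 3 = (pi / 6) *+ 2); last by field.
by rewrite cos_mulr2n cos2sin2 sin_pi6; field.
Qed.

(** Cosine is injective on [0, pi], so each sign of cos (pi t) leaves one solution of |2 cos (pi t)|
    = 1. These are the parameters at which Jensen's formula is not applied. *)
Lemma normc1D_e2pi_eq1 (R : realType) (t : R) : 0 <= t -> t <= 1 ->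
  ComplexField.Normc.normc (1 + e2pi t) = 1 -> t = 3^-1 \/ t = 2 / 3.
Proof.
move=> t0 t1; rewrite normc1D_e2pi; have p0 := pi_gt0 R.
have inj (s : R) : 0 <= s -> s <= 1 -> cos (pi * t) = cos (pi * s) -> t = s.
  move=> s0 s1 /cos_inj; rewrite !in_itv/= => H.
  by apply: (mulfI (lt0r_neq0 p0)); apply: H; apply/andP; split; nra.
have [c0|c0] := leP 0 (2 * cos (pi * t)).
- rewrite ger0_norm// => c1; left; apply: inj; [lra|lra|].
  by rewrite cos_pi3; lra.
- rewrite ltr0_norm// => c1; right; apply: inj; [lra|lra|].
  rewrite (_ : pi * (2 / 3) = - (pi / 3) + pi); last by field.
  by rewrite cosDpi cosN cos_pi3; lra.
Qed.

(** * From the Mahler measure to log-sine integrals *)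

Section MahlerLogSine.
Import numFieldNormedType.Exports.
Local Open Scope classical_set_scope.
Context {R : realType}.
Notation mu := (@lebesgue_measure R).

(** Truncation at 1 keeps the argument of [ln] positive, so zeros of [u] do no harm. *)
Lemma continuous_ln_max_pow (u : R -> R) k : continuous u ->
  continuous (fun t => ln (Num.max 1 `|u t|) ^+ k).
Proof.
move=> cu.
have cn : continuous (fun t => `|u t|).
  by move=> t; exact: (cvg_norm (cu t)).
have cmax : continuous ((cst 1 : R -> R) \max (fun t => `|u t|)).
  by move=> t; apply: continuous_max; [exact: cst_continuous|exact: cn].
have cln : continuous (fun t => ln (Num.max 1 `|u t|)).
  move=> t; apply: (continuous_comp (cmax t)); apply: continuous_ln.
  by rewrite lt_max ltr01.
by move=> t; exact: (continuous_comp (cln t) (@exprn_continuous _ k _)).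
Qed.

(** Both halves of [0, 1] give the same integral [I]: t = s + 1/2 on the right and t = 1/2 - s on
    the left turn the cosine into a sine up to sign, and x = 2 pi s stretches [0, 1/2] to
    [0, pi]. *)
Lemma Rintegral_ln_max_cos k :
  Rintegral mu `[0, 1] (fun t => ln (Num.max 1 `|2 * cos (pi * t)|) ^+ k) =
  pi^-1 * Rintegral mu `[0, pi] (fun x => ln (Num.max 1 `|2 * sin (x / 2)|) ^+ k).
Proof.
set g := fun t : R => ln (Num.max 1 `|2 * cos (pi * t)|) ^+ k.
set h := fun x : R => ln (Num.max 1 `|2 * sin (x / 2)|) ^+ k.
have p0 := pi_gt0 R.
have cg : continuous g.
  apply: continuous_ln_max_pow => t; apply: cvgM; first exact: cvg_cst.
  apply: continuous_comp; last exact: continuous_cos.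
  exact: mulrl_continuous.
have ch : continuous h by apply: continuous_ln_max_pow; exact: continuous_two_sin_half.
have gD t : g (t + 2^-1) = h (2 * pi * t + 0).
  rewrite /g /h (_ : pi * (t + 2^-1) = pi * t + pi / 2); last by field.
  rewrite cosDpihalf mulrN normrN.
  by rewrite (_ : (2 * pi * t + 0) / 2 = pi * t); last by field.
have gB t : g (- t + 2^-1) = h (2 * pi * t + 0).
  rewrite -gD /g (_ : pi * (- t + 2^-1) = - (pi * (t + 2^-1)) + pi); last by field.
  by rewrite cosDpi cosN mulrN normrN.
have cgD : continuous (fun t : R => g (1 * t + 2^-1)).
  have cD : continuous (fun t : R => 1 * t + 2^-1).
    move=> t; apply: cvgD; [exact: mulrl_continuous|exact: cvg_cst].
  by move=> t; apply: (continuous_comp (cD t)); exact: cg.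
rewrite (@Rintegral_split _ _ 0 2^-1 1); [|lra|lra|]; last first.
  exact: continuous_integrable_segment.
set I := Rintegral mu `[0, 2^-1] (fun t => h (2 * pi * t + 0)).
have -> : Rintegral mu `[2^-1, 1] g = I.
  have := @Rintegral_affine _ _ 1 2^-1 0 2^-1 ltr01 _ cg.
  rewrite (_ : 1 * 0 + 2^-1 = 2^-1 :> R); last by ring.
  rewrite (_ : 1 * 2^-1 + 2^-1 = 1 :> R); last by field.
  move=> ->; last lra.
  by rewrite mul1r; apply: eq_Rintegral => t _; rewrite mul1r gD.
have -> : Rintegral mu `[0, 2^-1] g = I.
  (* The upper bound is written [- 0] so that the segment has the form that [Rintegral_opp]
     reflects. *)
  have := @Rintegral_affine _ _ 1 2^-1 (- 2^-1) (- 0) ltr01 _ cg.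
  rewrite (_ : 1 * - 2^-1 + 2^-1 = 0 :> R); last by field.
  rewrite (_ : 1 * - 0 + 2^-1 = 2^-1 :> R); last by field.
  move=> ->; last lra.
  rewrite Rintegral_opp; [|lra|exact: cgD].
  by rewrite mul1r; apply: eq_Rintegral => t _; rewrite mul1r gB.
have := @Rintegral_affine _ _ (2 * pi) 0 0 2^-1 _ _ ch.
rewrite (_ : 2 * pi * 0 + 0 = 0 :> R); last by ring.
rewrite (_ : 2 * pi * 2^-1 + 0 = pi :> R); last by field.
move=> ->; [|lra|lra].
by rewrite -/I -mulrA mulrCA mulKf ?lt0r_neq0// mulr_natl mulr2n.
Qed.

(** The signs in [Ls] make the right side the integral of the plain log-sine power over
    [pi / 3, pi], where the truncation is inactive; on [0, pi / 3] the truncated power vanishes. *)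
Lemma Rintegral_ln_max_sin k : (0 < k)%N ->
  Rintegral mu `[0, pi] (fun x => ln (Num.max 1 `|2 * sin (x / 2)|) ^+ k) =
  Ls k.+1 (pi / 3) - Ls k.+1 pi.
Proof.
move=> k0; have p0 := pi_gt0 R.
have ch : continuous (fun x : R => ln (Num.max 1 `|2 * sin (x / 2)|) ^+ k).
  by apply: continuous_ln_max_pow; exact: continuous_two_sin_half.
rewrite /Ls /= ifT; last lra.
rewrite ifT; last lra.
rewrite (@Rintegral_split _ _ 0 (pi / 3) pi); [|lra|lra|]; last first.
  exact: continuous_integrable_segment.
rewrite [X in _ = _ - - X](@Rintegral_split _ _ 0 (pi / 3) pi); [|lra|lra|]; last first.
  exact: integrable_ln_sin_pow.
rewrite opprK addKr.
rewrite [X in X + _](_ : _ = Rintegral mu `[0, pi / 3] (cst 0)); last first.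
  apply: eq_Rintegral => x; rewrite inE/= in_itv/= => /andP[x0 x3].
  have s1 := sin_le_half _ x0 x3.
  have s0 : 0 <= sin (x / 2) by apply: sin_ge0_pi; apply/andP; split; lra.
  rewrite max_l; last by rewrite ger0_norm; lra.
  (* Positivity of [k] enters here: 0 to the power 0 would be 1. *)
  by rewrite ln1 expr0n gtn_eqF.
rewrite Rintegral_cst// mul0r add0r.
apply: eq_Rintegral => x; rewrite inE/= in_itv/= => /andP[x3 xpi].
have s1 := sin_ge_half _ x3 xpi.
by rewrite max_r// ger0_norm; lra.
Qed.

Lemma multi_mahler_ln_max k :
  multi_mahler (n := k.+1)
    [seq (fun z : 'I_k.+1 -> R[i] => 1 + z ord0 + z (lift ord0 j)) | j <- enum 'I_k]
  = Rintegral mu `[0, 1] (fun t => ln (Num.max 1 `|2 * cos (pi * t)|) ^+ k).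
Proof.
rewrite multi_mahler_pencil; apply: (@eq_Rintegral_setD2 _ 3^-1 (2 / 3)) => //.
  apply: measurable_funS measurableT _ _ => //.
  apply: continuous_measurable_fun; apply: continuous_ln_max_pow => t.
  apply: cvgM; first exact: cvg_cst.
  apply: continuous_comp; last exact: continuous_cos.
  exact: mulrl_continuous.
move=> t; rewrite /= in_itv/= => /andP[t0 t1] /eqP t13 /eqP t23.
have a1 : ComplexField.Normc.normc (1 + e2pi t) != 1.
  by apply/eqP => /(normc1D_e2pi_eq1 _ _ t0 t1)[].
(* With t fixed, each y_j contributes the same circle mean, taken at a = 1 + e(t). *)
rewrite (@cube_integral_prod _ _ 1
  (fun s => ln (ComplexField.Normc.normc (1 + e2pi t + e2pi s)))).
  by rewrite mul1r -/(circle_log_mean _) circle_log_meanE// normc1D_e2pi.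
by apply: continuous_integrable_segment; exact: continuous_ln_normcD_e2pi.
Qed.

End MahlerLogSine.

(* variables: x = index ord0, y_j = index (lift ord0 j), j : 'I_k;
   k + 1 variables in total *)
Theorem theorem2p1 (R : realType) (k : nat) (hk : (0 < k)%N) :
  multi_mahler (n := k.+1)
    [seq (fun z : 'I_k.+1 -> R[i] => 1 + z ord0 + z (lift ord0 j)) | j <- enum 'I_k]
  = pi^-1 * Ls k.+1 (pi / 3) - pi^-1 * Ls k.+1 (pi : R).
Proof.
by rewrite multi_mahler_ln_max Rintegral_ln_max_cos Rintegral_ln_max_sin// mulrBr.
Qed.
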